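(* Let $q$ be a prime power, $n\geq 8$ an integer, and $s=\lfloor n/2\rfloor-2$. Let $\theta_0>\theta_1>\dots>\theta_{\lfloor n/2\rfloor}$ be the distinct eigenvalues of the adjacency matrix $A$ of the alternating bilinear forms graph $\Gamma(\mathrm{Alt}_n(\mathbb{F}_q))$, and let $\Delta=\max_{u}(A^3)_{u,u}$. Then $$q^{\frac{n(n-1)}{2}}\cdot\frac{\Delta-\theta_0\left(\theta_s+\theta_{s+1}+\theta_{\lfloor n/2\rfloor}\right)-\theta_s\theta_{s+1}\theta_{\lfloor n/2\rfloor}}{(\theta_0-\theta_s)(\theta_0-\theta_{s+1})(\theta_0-\theta_{\lfloor n/2\rfloor})}=q^{\frac{n(n-1)}{2\lfloor n/2\rfloor}\left(\lfloor n/2\rfloor-3\right)},$$ i.e. the Ratio-type bound on the $3$-independence number of this graph coincides with the Singleton-like bound for alternating codes of minimum rank distance $8$.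
   Context: $\mathrm{Alt}_n(\mathbb{F}_q)$ is the $\mathbb{F}_q$-space of $n\times n$ alternating matrices over $\mathbb{F}_q$ (i.e. $A=-A^\top$ with zero diagonal); it has $q^{n(n-1)/2}$ elements. The alternating bilinear forms graph $\Gamma(\mathrm{Alt}_n(\mathbb{F}_q))$ has vertex set $\mathrm{Alt}_n(\mathbb{F}_q)$, with $A,B$ adjacent iff $\mathrm{rk}(A-B)=2$. Its distinct adjacency eigenvalues are $\theta_x=P^{(n)}(x)=\frac{q^{2n-2x-1}-q^n-q^{n-1}+1}{q^2-1}$ for $x\in\{0,1,\dots,\lfloor n/2\rfloor\}$, listed in decreasing order. *)

(* Defs.v *)
From HB Require Import structures.
From mathcomp Require Import all_boot all_order all_algebra.
From mathcomp Require Import reals exp.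

Set Implicit Arguments.
Unset Strict Implicit.
Unset Printing Implicit Defensive.

Import Order.TTheory GRing.Theory Num.Theory.
Local Open Scope ring_scope.

(* The zero-diagonal condition is not redundant in characteristic 2. *)
Definition alternating (F : fieldType) (n : nat) (A : 'M[F]_n) : bool :=
  (A == - A^T) && [forall i, A i i == 0].

Definition Alt (n : nat) (F : finFieldType) : finType :=
  {A : 'M[F]_n | alternating A}.

Definition alt_graph (n : nat) (F : finFieldType) : rel (Alt n F) :=
  fun A B => \rank (val A - val B) == 2%N.

Definition adjmx (R : pzSemiRingType) (V : finType) (e : rel V) : 'M[R]_#|V| :=
  \matrix_(i, j) (e (enum_val i) (enum_val j))%:R.

(* theta 0 > theta 1 > ... > theta d are the distinct eigenvalues of A;
   the values theta i for i > d are irrelevant. *)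
Definition distinct_eigenvalues (R : realFieldType) (N : nat) (A : 'M[R]_N)
    (d : nat) (theta : nat -> R) : Prop :=
  (forall i j : nat, (i < j <= d)%N -> theta j < theta i) /\
  (forall a : R, eigenvalue A a <-> exists2 i : nat, (i <= d)%N & a = theta i).

(* The default value 0 is harmless: the entries of powers of an adjacency
   matrix are nonnegative. *)
Definition max_diag (R : realFieldType) (N : nat) (A : 'M[R]_N) : R :=
  \big[Num.max/0]_(u < N) A u u.

(* Main.v *)
Require Import Defs.
From HB Require Import structures.
From mathcomp Require Import all_boot all_order all_algebra.
From mathcomp Require Import mxabelem zify ring lra.
From mathcomp Require Import reals exp.

Set Implicit Arguments.
Unset Strict Implicit.
Unset Printing Implicit Defensive.

Import Order.TTheory GRing.Theory Num.Theory.
Local Open Scope ring_scope.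

(** The graph is a Cayley graph, and complex characters can be avoided: for any
    matrix [G], the function [N |-> q * [tr (N G) = 0] - 1], a sum of the
    nontrivial scalings of one character, is a rational eigenvector. Its
    eigenvalue only requires counting the alternating [N] of rank 2 with
    [tr (N G) = t]. Those [N] are the matrices [u^T v - v^T u] with [u, v]
    independent, each obtained from [|SL_2(q)| = q (q^2 - 1)] pairs, so the
    count reduces to pairs of vectors and depends on [rank (G^T - G)] alone.
    Letting that rank run through [0, 2, ..., 2 floor(n/2)] yields
    [floor(n/2) + 1] distinct eigenvalues, hence all of them.

    For the closed 3-walks, a difference of two rank 2 alternating matrices has
    rank 4 exactly when the four underlying vectors are independent, and never
    rank 1 or 3, so the common neighbours are counted by complement. What is
    left is an identity between rational functions of [q] and [q^(n-1)]. *)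

(** * Alternating matrices *)

Section AlternatingMatrices.
Variable F : fieldType.

(** The strictly upper triangular part of [A] serves as [G], in characteristic 2 as well. Closure
    properties and small determinants then become formal identities in [G]. *)
Lemma alternatingP n (A : 'M[F]_n) :
  reflect (exists G : 'M[F]_n, A = G - G^T) (alternating A).
Proof.
apply: (iffP andP) => [[/eqP skA /forallP dA] | [G ->]]; last first.
  split; first by rewrite raddfB /= trmxK opprB.
  by apply/forallP => i; rewrite !mxE subrr.
exists (\matrix_(i, j) if (i < j)%N then A i j else 0).
apply/matrixP => i j; rewrite !mxE.
case: ltngtP => [|_|/val_inj <-]; rewrite ?subr0 ?(eqP (dA i)) // sub0r.
by rewrite {1}skA !mxE.
Qed.

Lemma alternating0 n : alternating (0 : 'M[F]_n).
Proof. by apply/alternatingP; exists 0; rewrite trmx0 subrr. Qed.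

Lemma alternatingB n (A B : 'M[F]_n) :
  alternating A -> alternating B -> alternating (A - B).
Proof.
move=> /alternatingP[G ->] /alternatingP[H ->]; apply/alternatingP.
by exists (G - H); rewrite [(G - H)^T]raddfB /= !opprD addrACA.
Qed.

Lemma alternatingD n (A B : 'M[F]_n) :
  alternating A -> alternating B -> alternating (A + B).
Proof.
move=> /alternatingP[G ->] /alternatingP[H ->]; apply/alternatingP.
by exists (G + H); rewrite raddfD /= opprD addrACA.
Qed.

Lemma alternating_congr n k (A : 'M[F]_n) (P : 'M[F]_(n, k)) :
  alternating A -> alternating (P^T *m A *m P).
Proof.
move=> /alternatingP[G ->]; apply/alternatingP; exists (P^T *m G *m P).
by rewrite mulmxBr mulmxBl !trmx_mul trmxK mulmxA.
Qed.

Lemma mulmx_row_free_congr_inj n k (P : 'M[F]_(k, n)) (A B : 'M[F]_k) :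
  row_free P -> P^T *m A *m P = P^T *m B *m P -> A = B.
Proof.
move=> fP /(row_free_inj fP) eqAB.
by apply/trmx_inj/(row_free_inj fP); rewrite -[P]trmxK -!trmx_mul eqAB.
Qed.

Lemma mxrank_row_free_congr n k (P : 'M[F]_(k, n)) (A : 'M[F]_k) :
  row_free P -> \rank (P^T *m A *m P) = \rank A.
Proof.
by move=> fP; rewrite mxrankMfree // -mxrank_tr trmx_mul trmxK mxrankMfree // mxrank_tr.
Qed.

(** Skewness lets [A] factor on both sides through a basis [P] of its row space, so [A] is the
    pullback of a nondegenerate form on a space of dimension [r]. *)
Lemma alternating_reduction n (A : 'M[F]_n) r :
  alternating A -> \rank A = r ->
  exists (P : 'M[F]_(r, n)) (M : 'M[F]_r),
    [/\ row_free P, alternating M, M \in unitmx & A = P^T *m M *m P].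
Proof.
move=> aA rA; case: r / rA.
have skA : A^T = - A by case/andP: aA => /eqP eA _; rewrite [in RHS]eA opprK.
have [B fB /submxP[D eD]] : exists2 B : 'M_(\rank A, n), row_free B & (A <= B)%MS.
  by exists (row_base A); rewrite ?row_base_free ?eq_row_base.
have [Q BQ] := row_freeP fB.
have AE : A = A *m Q *m B.
  have : D *m B *m Q *m B = D *m B by rewrite -(mulmxA D) BQ mulmx1.
  by rewrite -eD.
have AE' : A = B^T *m Q^T *m A.
  by apply: trmx_inj; rewrite !trmx_mul !trmxK skA mulNmx mulmxA -AE.
exists B, (Q^T *m A *m Q).
have AE2 : A = B^T *m (Q^T *m A *m Q) *m B by rewrite !mulmxA -AE' -AE.
split=> //; first exact: alternating_congr.
by rewrite -row_free_unit /row_free -(mxrank_row_free_congr _ fB) -AE2.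
Qed.

Lemma alternating_rank1 n (A : 'M[F]_n) : alternating A -> \rank A != 1%N.
Proof.
move=> aA; apply/eqP => /(alternating_reduction aA)[P [M [_ aM]]].
rewrite unitmxE det_mx11.
by case/andP: aM => _ /forallP/(_ 0)/eqP ->; rewrite unitr0.
Qed.

(** The determinant of a 3 by 3 matrix [G - G^T] vanishes identically as a polynomial in the entries
    of [G], whatever the characteristic. *)
Lemma alternating_rank3 n (A : 'M[F]_n) : alternating A -> \rank A != 3%N.
Proof.
move=> aA; apply/eqP => /(alternating_reduction aA)[P [M [_ /alternatingP[G ->]]]].
rewrite unitmxE; suff -> : \det (G - G^T) = 0 by rewrite unitr0.
do 2?rewrite !(expand_det_row _ ord0) !big_ord_recl !big_ord0 /cofactor /=.
rewrite !det_mx11 !mxE /=.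
(* Indexing by naturals gives equal entries the same syntactic form, as [ring] requires of its
   atoms. *)
pose g a b := G (inord a) (inord b).
have gE i j : G i j = g i j by rewrite /g !inord_val.
rewrite !gE /= /bump /=.
ring.
Qed.

Definition symplectic k : 'M[F]_(k + k) := block_mx 0 1%:M (- 1%:M) 0.

Lemma symplectic_unit k : symplectic k \in unitmx.
Proof.
have /mulmx1_unit[] // : symplectic k *m (- symplectic k) = 1%:M.
rewrite mulmxN mulmx_block !mul0mx !mulmx0 !mul1mx mulmx1 !(addr0, add0r).
by rewrite opp_block_mx opprK oppr0 -scalar_mx_block.
Qed.

Lemma alternating_mx2 (M : 'M[F]_(1 + 1)) :
  alternating M -> M = M 0 1 *: symplectic 1.
Proof.
move=> /alternatingP[G ->]; apply/matrixP => i j; rewrite [RHS]mxE.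
have e0 : 0 = lshift 1 0 :> 'I_(1 + 1) by apply/val_inj.
have e1 : 1 = rshift 1 0 :> 'I_(1 + 1) by apply/val_inj.
rewrite e0 e1 /symplectic.
case: (split_ordP i) => i1 ->; case: (split_ordP j) => j1 ->; rewrite !ord1.
- by rewrite block_mxEul !mxE subrr mulr0.
- by rewrite block_mxEur !mxE mulr1.
- by rewrite block_mxEdl !mxE /= mulrN1 opprB.
- by rewrite block_mxEdr !mxE subrr mulr0.
Qed.

End AlternatingMatrices.

(** * Alternating matrices of rank two *)

Section Wedge.
Variable F : fieldType.

(** The exterior product of the two rows of [X], written as a congruence so that the rank lemmas
    above apply. The height [1 + 1] fits rows stacked by [col_mx]. *)
Definition wedge n (X : 'M[F]_(1 + 1, n)) : 'M[F]_n :=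
  X^T *m symplectic F 1 *m X.

Lemma wedge_col_mx n (u v : 'rV[F]_n) :
  wedge (col_mx u v) = u^T *m v - v^T *m u.
Proof.
rewrite /wedge tr_col_mx mul_row_block !mulmx0 mulmx1 add0r addr0 mul_row_col.
by rewrite mulmxN mulmx1 mulNmx addrC.
Qed.

Lemma alternating_wedge n (X : 'M[F]_(1 + 1, n)) : alternating (wedge X).
Proof.
apply: alternating_congr; apply/alternatingP; exists (block_mx 0 1%:M 0 0).
rewrite tr_block_mx opp_block_mx add_block_mx !trmx0 trmx1.
by rewrite !oppr0 !addr0 add0r.
Qed.

Lemma mxrank_wedge n (X : 'M[F]_(1 + 1, n)) :
  row_free X -> \rank (wedge X) = 2%N.
Proof.
by move=> fX; rewrite mxrank_row_free_congr // mxrank_unit ?symplectic_unit.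
Qed.

Lemma row_free_wedge n (X : 'M[F]_(1 + 1, n)) :
  \rank (wedge X) = 2%N -> row_free X.
Proof.
move=> rX; have : (\rank (wedge X) <= \rank X)%N := mxrankM_maxr _ _.
by rewrite rX /row_free eqn_leq rank_leq_row.
Qed.

Lemma det_mx2 (M : 'M[F]_(1 + 1)) :
  \det M = M 0 0 * M 1 1 - M 0 1 * M 1 0.
Proof.
rewrite (expand_det_row _ 0) !big_ord_recl big_ord0 /cofactor !det_mx11 !mxE.
pose g a b := M (inord a) (inord b).
have gE i j : M i j = g i j by rewrite /g !inord_val.
by rewrite !gE /= /bump /=; ring.
Qed.

(** Alternating 2 by 2 matrices form a line, on which [wedge M] has coordinate [\det M]. Hence left
    multiplication by SL_2 preserves [wedge X]. *)
Lemma wedge_mul n (M : 'M[F]_(1 + 1)) (X : 'M[F]_(1 + 1, n)) :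
  wedge (M *m X) = \det M *: wedge X.
Proof.
have -> : wedge (M *m X) = X^T *m wedge M *m X.
  by rewrite /wedge trmx_mul !mulmxA.
rewrite (alternating_mx2 (alternating_wedge M)) -scalemxAr -scalemxAl.
congr (_ *: _).
rewrite -[M]vsubmxK wedge_col_mx !mxE !big_ord1 !mxE vsubmxK det_mx2.
have e0 : lshift 1 0 = 0 :> 'I_(1 + 1) by apply/val_inj.
have e1 : rshift 1 0 = 1 :> 'I_(1 + 1) by apply/val_inj.
by rewrite e0 e1; ring.
Qed.

Lemma alternating_rank2 n (N : 'M[F]_n) :
  alternating N -> \rank N = 2%N ->
  exists2 X : 'M[F]_(1 + 1, n), row_free X & N = wedge X.
Proof.
move=> aN rN.
have [P [M [fP aM uM eN]]] := @alternating_reduction _ _ _ (1 + 1) aN rN.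
suff [X eX] : exists X : 'M[F]_(1 + 1, n), N = wedge X.
  by exists X => //; apply: row_free_wedge; rewrite -eX.
(* The left factor has determinant [M 0 1], the scalar by which [M] differs from the symplectic
   matrix. *)
exists (block_mx (M 0 1)%:M 0 0 1%:M *m P).
rewrite wedge_mul det_ublock det_scalar1 det1 mulr1 eN.
by rewrite {1}(alternating_mx2 aM) -scalemxAr -scalemxAl.
Qed.

Lemma row_free_col_mx k n (M : 'M[F]_(k, n)) (v : 'rV[F]_n) :
  row_free (col_mx M v) = row_free M && ~~ (v <= M)%MS.
Proof.
rewrite /row_free -addsmxE; case: (boolP (v <= M)%MS) => [vM | vM].
  rewrite (addsmx_idPl vM) andbF; apply/negbTE; rewrite neq_ltn.
  by rewrite addn1 ltnS rank_leq_row.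
have rvM : \rank (M + v)%MS = (\rank M).+1.
  have v1 : \rank v = 1%N.
    by rewrite rank_rV; case: eqP vM => // ->; rewrite sub0mx.
  apply/eqP; rewrite eqn_leq; apply/andP; split.
    by rewrite (leq_trans (mxrank_adds_leqif _ _)) // v1 addn1.
  by apply: rank_ltmx; rewrite ltmxE addsmxSl addsmx_sub submx_refl.
by rewrite rvM addn1 eqSS andbT.
Qed.

Lemma row_free_col_mxA k n (M : 'M[F]_(k, n)) (u v : 'rV[F]_n) :
  row_free (col_mx M (col_mx u v)) = row_free (col_mx (col_mx M u) v).
Proof.
rewrite /row_free -!addsmxE -(adds_eqmx (eqmx_refl M) (addsmxE u v)) addsmxA.
by rewrite -(adds_eqmx (addsmxE M u) (eqmx_refl v)) addnA.
Qed.

(** The difference is the pullback, along the stacked matrix, of a nondegenerate form of size 4;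
    full rank of one is therefore full rank of the other. *)
Lemma mxrank_wedgeB n (X Y : 'M[F]_(1 + 1, n)) :
  (\rank (wedge X - wedge Y)%R == 4%N) = row_free (col_mx X Y).
Proof.
set Z := col_mx X Y.
have -> : wedge X - wedge Y =
    Z^T *m block_mx (symplectic F 1) 0 0 (- symplectic F 1) *m Z.
  by rewrite tr_col_mx mul_row_block !mulmx0 addr0 add0r mul_row_col mulmxN mulNmx.
apply/eqP/idP => [rZ | fZ].
  rewrite /row_free eqn_leq rank_leq_row /=.
  by rewrite -[X in (X <= _)%N]/4%N -rZ mxrankM_maxr.
rewrite mxrank_row_free_congr // rank_diag_block_mx mxrank_opp.
by rewrite !mxrank_unit ?symplectic_unit.
Qed.

(** The rank is at most 4 and never 1 or 3, so 2 is what remains once 4 and 0 are excluded. *)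
Lemma mxrank_wedgeB_eq2 n (X Y : 'M[F]_(1 + 1, n)) :
  (\rank (wedge X - wedge Y)%R == 2%N) =
  ~~ row_free (col_mx X Y) && (wedge Y != wedge X).
Proof.
rewrite -mxrank_wedgeB [wedge Y == _]eq_sym -subr_eq0 -mxrank_eq0.
have aB := alternatingB (alternating_wedge X) (alternating_wedge Y).
have := alternating_rank1 aB; have := alternating_rank3 aB.
have : (\rank (wedge X - wedge Y)%R <= 4)%N.
  rewrite (leq_trans (mxrank_add _ _)) // mxrank_opp.
  by rewrite (@leq_add _ _ 2 2) // (leq_trans (mxrankM_maxr _ _)) ?rank_leq_row.
by move: (\rank _) => [|[|[|[|[|]]]]].
Qed.

Lemma row_freeE_wedge n (X : 'M[F]_(1 + 1, n)) :
  row_free X = (wedge X != 0).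
Proof.
apply/idP/idP => [fX | ]; first by rewrite -mxrank_eq0 mxrank_wedge.
have := alternating_rank1 (alternating_wedge X).
have : (\rank (wedge X) <= 2)%N by rewrite (leq_trans (mxrankM_maxr _ _)) ?rank_leq_row.
rewrite -mxrank_eq0 => r2 r1 r0; apply: row_free_wedge.
by case: (\rank _) r2 r1 r0 => [|[|[|]]].
Qed.

(** For fixed [u] this makes the trace linear in [v], so that prescribing it amounts to a hyperplane
    condition. *)
Lemma trace_wedge n (G : 'M[F]_n) (u v : 'rV[F]_n) :
  \tr (wedge (col_mx u v) *m G) = (u *m (G^T - G) *m v^T) 0 0.
Proof.
rewrite wedge_col_mx mulmxBl raddfB /= mulmxBr mulmxBl.
rewrite [RHS]mxE [X in _ = _ + X]mxE; congr (_ - _).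
  rewrite -[u^T *m v *m G]mulmxA mxtrace_mulC -mxtrace_tr trace_mx11.
  by rewrite !trmx_mul trmxK mulmxA.
by rewrite -[v^T *m u *m G]mulmxA mxtrace_mulC trace_mx11.
Qed.

End Wedge.

(** * Counting over a finite field *)

Section Counting.
Variable F : finFieldType.
Local Notation q := #|F|.

Lemma card_submx k n (M : 'M[F]_(k, n)) :
  #|[set v : 'rV[F]_n | (v <= M)%MS]| = (q ^ \rank M)%N.
Proof. exact: card_rowg. Qed.

Lemma card_not_submx k n (M : 'M[F]_(k, n)) :
  #|[set v : 'rV[F]_n | ~~ (v <= M)%MS]| = (q ^ n - q ^ \rank M)%N.
Proof.
have -> : [set v : 'rV[F]_n | ~~ (v <= M)%MS] =
    ~: [set v : 'rV[F]_n | (v <= M)%MS] by apply/setP => v; rewrite !inE.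
by rewrite cardsCs setCK card_submx card_mx mul1n.
Qed.

Lemma card_kermx n k (D : 'M[F]_(n, k)) :
  #|[set u : 'rV[F]_n | u *m D == 0]| = (q ^ (n - \rank D))%N.
Proof.
rewrite -mxrank_ker -card_submx; apply: eq_card => u; rewrite !inE.
exact/eqP/sub_kermxP.
Qed.

Lemma card_hyperplane n (w : 'rV[F]_n) (t : F) :
  w != 0 -> #|[set v : 'rV[F]_n | (w *m v^T) 0 0 == t]| = (q ^ n.-1)%N.
Proof.
move=> w0.
have [i wi] : exists i, w 0 i != 0.
  apply/existsP; apply: contraR w0; rewrite negb_exists => /forallP w0.
  by apply/eqP/rowP => i; rewrite mxE; apply/eqP; rewrite -[_ == _]negbK.
(* A particular solution, supported where [w] is nonzero; the solution set is its translate by the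
   kernel. *)
pose v0 : 'rV[F]_n := (t / w 0 i) *: delta_mx 0 i.
have wv0 : (w *m v0^T) 0 0 = t.
  rewrite linearZ /= -scalemxAr trmx_delta -colE !mxE.
  by rewrite divfK.
have -> : [set v : 'rV[F]_n | (w *m v^T) 0 0 == t] =
    [set v + v0 | v in [set v : 'rV[F]_n | v *m w^T == 0]].
  apply/setP => v; rewrite inE; apply/eqP/imsetP => [wv | [v1]].
    exists (v - v0); last by rewrite subrK.
    rewrite inE -[v - v0]trmxK -trmx_mul raddfB /= mulmxBr trmx_eq0.
    by apply/eqP/matrixP => a b; rewrite !ord1 [LHS]mxE [X in _ + X]mxE wv wv0 subrr mxE.
  rewrite inE => /eqP v1w ->.
  rewrite raddfD /= mulmxDr mxE wv0 -[w *m _]trmxK trmx_mul trmxK v1w.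
  by rewrite !mxE add0r.
rewrite card_imset; last exact: addIr.
by rewrite card_kermx mxrank_tr rank_rV w0 subn1.
Qed.

Lemma card_mx2 n (p : pred 'M[F]_(1 + 1, n)) :
  #|[set X | p X]| = (\sum_(u : 'rV[F]_n) #|[set v | p (col_mx u v)]|)%N.
Proof.
under eq_bigr => u _ do rewrite -sum1dep_card.
rewrite pair_big_dep -sum1dep_card.
rewrite (reindex (fun uv : 'rV[F]_n * 'rV[F]_n => col_mx uv.1 uv.2)) //=.
exists (fun X => (usubmx X, dsubmx X)) => [[u v] _ | X _] /=.
  by rewrite col_mxKu col_mxKd.
exact: vsubmxK.
Qed.

(** The first new row avoids a space of dimension [k], the second the enlarged space of dimension
    [k + 1]. *)
Lemma card_row_free_ext k n (M : 'M[F]_(k, n)) :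
  row_free M ->
  #|[set X : 'M[F]_(1 + 1, n) | row_free (col_mx M X)]| =
  ((q ^ n - q ^ k) * (q ^ n - q ^ k.+1))%N.
Proof.
move=> fM; have := card_not_submx M; rewrite (eqP fM) => <-.
rewrite card_mx2 -sum_nat_const.
rewrite [RHS]big_mkcond /=; apply: eq_bigr => u _; rewrite inE.
under eq_finset => v do rewrite row_free_col_mxA row_free_col_mx.
case: ifP => uM; last first.
  by apply: eq_card0 => v; rewrite inE row_free_col_mx uM andbF.
have fMu : row_free (col_mx M u) by rewrite row_free_col_mx fM uM.
by rewrite fMu card_not_submx (eqP fMu) addn1.
Qed.

Lemma card_row_free2 n :
  #|[set X : 'M[F]_(1 + 1, n) | row_free X]| =
  ((q ^ n - 1) * (q ^ n - q))%N.
Proof.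
have f0 : row_free (0 : 'M[F]_(0, n)) by rewrite /row_free mxrank0.
have := card_row_free_ext f0; rewrite expn0 expn1 => <-; apply: eq_card => X; rewrite !inE.
by rewrite /row_free -addsmxE adds0mx.
Qed.

(** This is the order of SL_2: the determinant is the symplectic pairing of the rows, so each
    nonzero first row leaves an affine line of [q] second rows. *)
Lemma card_det1 :
  #|[set M : 'M[F]_(1 + 1) | \det M == 1]| = (q * (q ^ 2 - 1))%N.
Proof.
have detE (u v : 'rV[F]_(1 + 1)) :
    \det (col_mx u v) = (u *m symplectic F 1 *m v^T) 0 0.
  have e0 : 0 = lshift 1 0 :> 'I_(1 + 1) by apply/val_inj.
  have e1 : 1 = rshift 1 0 :> 'I_(1 + 1) by apply/val_inj.
  rewrite det_mx2 e0 e1 !col_mxEu !col_mxEd -e0 -e1.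
  rewrite -[u in RHS]hsubmxK -[v in RHS]hsubmxK mul_row_block tr_row_mx.
  rewrite !mulmx0 mulmxN !mulmx1 add0r addr0 mul_row_col mulNmx !mxE !big_ord1.
  by rewrite !mxE -e0 -e1; ring.
rewrite card_mx2.
have -> : (q ^ 2 - 1)%N = #|[set~ (0 : 'rV[F]_(1 + 1))]|.
  by rewrite cardsC1 card_mx mul1n subn1.
rewrite mulnC -sum_nat_const [RHS]big_mkcond /=.
apply: eq_bigr => u _; rewrite !inE.
under eq_finset => v do rewrite detE.
have [-> | u0] /= := eqVneq u 0.
  by apply: eq_card0 => v; rewrite inE !mul0mx mxE eq_sym oner_eq0.
rewrite card_hyperplane ?expn1 //; apply: contraNneq u0 => uJ0.
by rewrite -[u](mulmxK (symplectic_unit F 1)) uJ0 mul0mx.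
Qed.

(** The fibre is an SL_2-orbit: [wedge X] has the row space of [X], so equal wedges give
    [X = M *m X0], and cancelling [X0] forces determinant 1. *)
Lemma card_wedge_fiber n (X0 : 'M[F]_(1 + 1, n)) :
  row_free X0 ->
  #|[set X | wedge X == wedge X0]| = (q * (q ^ 2 - 1))%N.
Proof.
move=> fX0; rewrite -card_det1.
rewrite -(card_imset _ (@row_free_inj _ (1 + 1) _ _ _ fX0)).
apply: eq_card => X; rewrite inE; apply/eqP/imsetP => [eX | [M]]; last first.
  by rewrite inE => /eqP dM ->; rewrite wedge_mul dM scale1r.
have fX : row_free X by rewrite row_free_wedge // eX mxrank_wedge.
have sub (Y : 'M[F]_(1 + 1, n)) : row_free Y -> (wedge Y :=: Y)%MS.
  move=> fY; apply/eqmxP; rewrite -mxrank_leqif_eq ?submxMl //.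
  by rewrite mxrank_wedge // (eqP fY).
have /submxP[M eM] : (X <= X0)%MS by rewrite -(sub _ fX0) -eX sub.
exists M => //; rewrite inE.
have e01 := mulmx_row_free_congr_inj fX0.
have : \det M *: symplectic F 1 = symplectic F 1.
  by apply: e01; rewrite -scalemxAr -scalemxAl -wedge_mul -eM.
move/matrixP/(_ (lshift 1 0) (rshift 1 0)).
by rewrite mxE /symplectic block_mxEur !mxE mulr1 => /eqP.
Qed.

(** Since all fibres of [wedge] have the size of SL_2, counts of rank 2 matrices reduce to counts of
    independent pairs of vectors. *)
Lemma card_wedge n (p : pred 'M[F]_n) :
  #|[set X : 'M[F]_(1 + 1, n) | row_free X && p (wedge X)]| =
  (#|[set N | [&& alternating N, \rank N == 2%N & p N]]| *
    (q * (q ^ 2 - 1)))%N.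
Proof.
pose S := [pred N : 'M[F]_n | [&& alternating N, \rank N == 2%N & p N]].
rewrite -[LHS]sum1dep_card (partition_big (@wedge F n) S); last first.
  by move=> X /andP[fX pX]; rewrite /= alternating_wedge mxrank_wedge.
rewrite -sum_nat_const; apply: eq_big => [N | N /and3P[aN /eqP rN pN]].
  by rewrite inE.
have [X0 fX0 eN] := alternating_rank2 aN rN.
rewrite -(card_wedge_fiber fX0) sum1dep_card; apply: eq_card => X.
rewrite !inE -eN; case: eqP => [eX | _]; rewrite ?andbF // eX pN !andbT.
by rewrite row_free_wedge // eX.
Qed.

End Counting.

(** * Numbers of rank two alternating matrices under trace and distance conditions *)

Section RankTwoCounts.
Variables (F : finFieldType) (n : nat).
Local Notation q := #|F|.

Definition alt2 (p : pred 'M[F]_n) : {set 'M[F]_n} :=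
  [set N | [&& alternating N, \rank N == 2%N & p N]].

Lemma card_alt2 :
  (#|alt2 predT| * (q * (q ^ 2 - 1)) = (q ^ n - 1) * (q ^ n - q))%N.
Proof.
rewrite -card_row_free2 -card_wedge.
by apply: eq_card => X; rewrite !inE andbT.
Qed.

(** A nonzero trace already forces [u] and [v] to be independent. The vector [u] ranges outside the
    kernel of [G^T - G], and [v] then over an affine hyperplane. *)
Lemma card_alt2_trace (G : 'M[F]_n) (t : F) : t != 0 ->
  (#|alt2 (fun N => \tr (N *m G) == t)| * (q * (q ^ 2 - 1)) =
   (q ^ n - q ^ (n - \rank (G^T - G)%R)) * q ^ n.-1)%N.
Proof.
move=> t0; rewrite -card_wedge card_mx2.
have -> : (q ^ n - q ^ (n - \rank (G^T - G)%R))%N =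
    #|[set u : 'rV[F]_n | u *m (G^T - G) != 0]|.
  rewrite -mxrank_ker -card_not_submx; apply: eq_card => u; rewrite !inE.
  by congr (~~ _); apply/sub_kermxP/eqP.
rewrite -sum_nat_const [RHS]big_mkcond /=; apply: eq_bigr => u _; rewrite inE.
have -> : [set v | row_free (col_mx u v) & \tr (wedge (col_mx u v) *m G) == t] =
    [set v | (u *m (G^T - G) *m v^T) 0 0 == t].
  apply/setP => v; rewrite !inE -trace_wedge andb_idl // row_freeE_wedge.
  by move/eqP => tE; apply: contraNneq t0 => w0; rewrite -tE w0 mul0mx mxtrace0.
have [-> | u0] /= := eqVneq (u *m (G^T - G)) 0; last by rewrite card_hyperplane.
by apply: eq_card0 => v; rewrite inE mul0mx mxE eq_sym (negbTE t0).
Qed.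

(** The preceding count is the same for every nonzero trace, so the [q - 1] nonzero values
    contribute equally. *)
Lemma card_alt2_trace0 (G : 'M[F]_n) (t : F) : t != 0 ->
  (#|alt2 predT| = #|alt2 (fun N => \tr (N *m G) == 0%R)| +
     q.-1 * #|alt2 (fun N => \tr (N *m G) == t)|)%N.
Proof.
move=> t0; rewrite -sum1dep_card (partition_big (fun N => \tr (N *m G)) predT) //=.
have E s : (\sum_(N : 'M[F]_n | [&& alternating N, \rank N == 2%N & true] &&
     (\tr (N *m G) == s)) 1)%N = #|alt2 (fun N => \tr (N *m G) == s)|.
  by rewrite sum1dep_card; apply: eq_card => N; rewrite !inE andbT andbA.
rewrite (bigD1 0) //= E; congr (_ + _)%N.
rewrite (eq_bigr (fun=> #|alt2 (fun N => \tr (N *m G) == t)|)); last first.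
  move=> s s0; rewrite E.
  have q1 := card_finRing_gt1 F.
  have K0 : (0 < q * (q ^ 2 - 1))%N.
    by rewrite muln_gt0 subn_gt0 ltnW //= (ltn_trans q1) // -{1}[q]expn1 ltn_exp2l.
  by apply/eqP; rewrite -(eqn_pmul2r K0) !card_alt2_trace.
by rewrite sum_nat_const cardC1.
Qed.

(** Both sides count independent pairs, split on the left by the rank 2, 0 or 4 of the difference
    from [N]; the successor accounts for [N] itself. *)
Lemma card_alt2_neighbours (N : 'M[F]_n) :
  alternating N -> \rank N = 2%N ->
  ((#|alt2 (fun M => \rank (N - M)%R == 2%N)|.+1) * (q * (q ^ 2 - 1)) +
    (q ^ n - q ^ 2) * (q ^ n - q ^ 3) = (q ^ n - 1) * (q ^ n - q))%N.
Proof.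
move=> aN rN; have [X0 fX0 ->] := alternating_rank2 aN rN.
rewrite mulSn -card_wedge -{1}(card_wedge_fiber fX0) -card_row_free2.
rewrite -[2%N]/(1 + 1)%N -(card_row_free_ext fX0).
set S1 := [set X | wedge X == _]; set S3 := [set X | row_free (col_mx _ _)].
set S2 := [set X | _ && _].
have -> : S2 = [set X | row_free X] :\: (S1 :|: S3).
  apply/setP => X; rewrite !inE mxrank_wedgeB_eq2 negb_or andbC.
  by congr (_ && _); rewrite andbC.
have dS : [disjoint S1 & S3].
  rewrite disjoint_subset; apply/subsetP => X; rewrite !inE => /eqP eX.
  by rewrite -mxrank_wedgeB eX subrr mxrank0.
have sS : S1 :|: S3 \subset [set X | row_free X].
  apply/subsetP => X; rewrite !inE => /orP[/eqP eX | fX].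
    by rewrite row_freeE_wedge eX -row_freeE_wedge.
  rewrite /row_free eqn_leq rank_leq_row /=.
  move: fX; rewrite /row_free -addsmxE => /eqP rX.
  have := (mxrank_adds_leqif X0 X).1; rewrite rX (eqP fX0) leq_add2l.
  by [].
have := cardsID (S1 :|: S3) [set X | row_free X].
rewrite (setIidPr sS) cardsU (disjoint_setI0 dS) cards0 subn0 => <-.
by rewrite addnAC.
Qed.

End RankTwoCounts.

(** Translation by [A] permutes the alternating matrices; this is the Cayley structure that moves
    every vertex to 0. *)
Lemma sum_Alt (R : nmodType) (F : finFieldType) n (A : Alt n F)
    (f : 'M[F]_n -> R) :
  \sum_(B : Alt n F) f (val B - val A) = \sum_(N | alternating N) f N.
Proof.
rewrite [RHS](reindex (fun B : Alt n F => val B - val A)) /=; last first.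
  exists (fun N => insubd A (N + val A)) => [B _ | N aN] /=.
    by rewrite subrK; apply/val_inj; rewrite val_insubd (valP B).
  by rewrite val_insubd alternatingD ?(valP A) // addrK.
by apply: eq_bigl => B; rewrite alternatingB ?(valP A) ?(valP B).
Qed.

Lemma sum_alt2 (R : pzSemiRingType) (F : finFieldType) n (p : pred 'M[F]_n) :
  \sum_(N | alternating N) (((\rank N == 2%N) && p N)%:R : R) = #|alt2 p|%:R.
Proof.
rewrite -sum1dep_card natr_sum [RHS]big_mkcond [LHS]big_mkcond /=.
by apply: eq_bigr => N _; case: alternating => //=; case: ifP.
Qed.

(** * The alternating forms graph *)

Lemma exists_skew_rank (F : fieldType) n x : (2 * x <= n)%N ->
  exists G : 'M[F]_n, \rank (G^T - G) = (2 * x)%N.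
Proof.
move=> le_xn; have -> : n = (x + x + (n - 2 * x))%N by lia.
move: (n - _)%N => r.
(* The lower left block of the symplectic matrix, padded by zeros: [G^T - G] is then minus the
   padded symplectic matrix. *)
exists (block_mx (block_mx 0 0 (- 1%:M) 0) 0 0 0).
rewrite tr_block_mx !trmx0 opp_block_mx add_block_mx !subrr.
rewrite rank_diag_block_mx mxrank0 addn0 tr_block_mx opp_block_mx add_block_mx.
rewrite !trmx0 raddfN /= trmx1 opprK !subrr add0r subr0.
move: (symplectic_unit F x).
have -> : symplectic F x = - block_mx 0 (- 1%:M) 1%:M 0.
  by rewrite opp_block_mx opprK !oppr0.
by rewrite -row_free_unit /row_free mxrank_opp => /eqP ->; lia.
Qed.

Section Graph.
Variables (R : realFieldType) (F : finFieldType) (n : nat).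
Local Notation q := #|F|.
Local Notation Q := (q%:R : R).
Local Notation A := (adjmx R (@alt_graph n F)).

(** The truncated subtractions in the exponents are exact when [0 < n] and [2 * x <= n]. *)
Definition alt_eigenvalue (x : nat) : R :=
  (Q ^+ (2 * n - 2 * x - 1) - Q ^+ n - Q ^+ (n - 1) + 1) / (Q ^+ 2 - 1).

Lemma natr_field_gt1 : 1 < Q.
Proof. by rewrite ltr1n card_finRing_gt1. Qed.

Lemma natr_field_sqrB1_neq0 : Q ^+ 2 - 1 != 0.
Proof. by have Q1 := natr_field_gt1; nra. Qed.

Lemma natr_field_neq0 : Q != 0.
Proof. by have Q1 := natr_field_gt1; nra. Qed.

Lemma natr_card_alt2 : (0 < n)%N ->
  #|@alt2 F n predT|%:R =
    (Q ^+ n - 1) * (Q ^+ (n - 1) - 1) / (Q ^+ 2 - 1) :> R.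
Proof.
move=> n0; have q1 := card_finRing_gt1 F; have Q1 := natr_field_gt1.
have /(congr1 (fun k => k%:R : R)) := card_alt2 F n.
rewrite !natrM !natrB ?natrX; first 1 last.
- by rewrite -{1}[q]expn1 leq_exp2l.
- by rewrite expn_gt0 ltnW.
- by rewrite expn_gt0 ltnW.
have -> : Q ^+ n = Q * Q ^+ (n - 1) by rewrite -exprS subn1 prednK.
move=> e; apply: (mulIf (mulf_neq0 natr_field_neq0 natr_field_sqrB1_neq0)).
by rewrite e; field; exact: natr_field_sqrB1_neq0.
Qed.

(** The eigenvalue is the character sum over rank 2 matrices, namely the number with trace 0 minus
    the number with trace [t], that is, the total minus [Q] times the latter. *)
Lemma natr_card_alt2_trace (G : 'M[F]_n) (t : F) x : t != 0 -> (2 * x <= n)%N ->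
  (0 < n)%N -> \rank (G^T - G) = (2 * x)%N ->
  Q * #|alt2 (fun N => \tr (N *m G) == t)|%:R =
    #|@alt2 F n predT|%:R - alt_eigenvalue x.
Proof.
move=> t0 xn n0 rG; have q1 := card_finRing_gt1 F; have Q1 := natr_field_gt1.
have /(congr1 (fun k => k%:R : R)) := card_alt2_trace G t0.
rewrite rG !natrM !natrB ?natrX; first 1 last.
- by rewrite leq_exp2l // leq_subr.
- by rewrite expn_gt0 ltnW.
rewrite natr_card_alt2 // /alt_eigenvalue -subn1.
have -> : (2 * n - 2 * x - 1 = (n - 1) + (n - 2 * x))%N by lia.
rewrite exprD.
have -> : Q ^+ n = Q * Q ^+ (n - 1) by rewrite -exprS subn1 prednK.
move=> e; apply: (mulIf natr_field_sqrB1_neq0).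
rewrite -[LHS]mulrA [LHS]mulrCA e.
by field; exact: natr_field_sqrB1_neq0.
Qed.

Lemma sum_enum (f : Alt n F -> R) :
  \sum_(i < #|Alt n F|) f (enum_val i) = \sum_B f B.
Proof.
rewrite [RHS](reindex (fun i : 'I_#|Alt n F| => enum_val i)) //.
exact/onW_bij/enum_val_bij.
Qed.

Lemma alt_graph_eigenvalue x : (0 < n)%N -> (2 * x <= n)%N ->
  eigenvalue A (alt_eigenvalue x).
Proof.
move=> n0 xn; have [G rG] := exists_skew_rank F xn; have Q1 := natr_field_gt1.
pose f (M : 'M[F]_n) : R := Q * (\tr (M *m G) == 0)%:R - 1.
apply/eigenvalueP; exists (\row_i f (val (enum_val i))); last first.
  (* The vector is nonzero because its entry at the zero matrix is [Q - 1]. *)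
  apply/eqP => /rowP/(_ (enum_rank (Sub 0 (alternating0 F n) : Alt n F))).
  by rewrite !mxE enum_rankK /f mul0mx mxtrace0 eqxx => /eqP; rewrite mulr1 subr_eq0 gt_eqF.
apply/rowP => j; rewrite !mxE.
set B := val (enum_val j).
under eq_bigr => i _ do rewrite !mxE /alt_graph.
rewrite (sum_enum (fun C => f (val C) * (\rank (val C - B)%R == 2%N)%:R)).
pose g N := f (N + B) * (\rank N == 2%N)%:R.
rewrite (eq_bigr (fun C => g (val C - B))); last by move=> C _; rewrite /g subrK.
rewrite sum_Alt.
have -> : \sum_(N | alternating N) g N =
   Q * #|alt2 (fun N => \tr (N *m G) == - \tr (B *m G))|%:R - #|@alt2 F n predT|%:R.
  rewrite -!sum_alt2 mulr_sumr -sumrB; apply: eq_bigr => N _.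
  rewrite /g /f mulmxDl raddfD /= addr_eq0 andbT.
  by case: (\rank N == 2%N); rewrite /= ?mulr1 ?mulr0 ?subrr.
(* If the trace at [B] is nonzero, then [f B = -1] and the nonzero-trace count applies directly;
   otherwise the trace-zero count is obtained by complement. *)
rewrite /f; have [t0 | t0] := eqVneq (\tr (B *m G)) 0; last first.
  by rewrite (natr_card_alt2_trace _ xn n0 rG) ?oppr_eq0 //=; ring.
have predQ : (q.-1)%:R = Q - 1 by rewrite -subn1 natrB // ltnW // card_finRing_gt1.
have e : #|@alt2 F n predT|%:R = #|alt2 (fun N => \tr (N *m G) == 0)|%:R +
    (Q - 1) * #|alt2 (fun N => \tr (N *m G) == 1)|%:R :> R.
  by rewrite (card_alt2_trace0 G (oner_neq0 F)) natrD natrM predQ.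
have key (a b c l : R) : a = b + (Q - 1) * c -> Q * c = a - l ->
    Q * b - a = l * (Q * 1 - 1).
  move=> e1 e2; have -> : b = a - (Q - 1) * c by rewrite e1 addrK.
  transitivity (Q * a - (Q - 1) * (Q * c) - a); first by ring.
  by rewrite e2; ring.
rewrite t0 oppr0.
exact: key e (natr_card_alt2_trace (oner_neq0 F) xn n0 rG).
Qed.

(** The number of common neighbours of 0 and [N], the same for every edge; [3 <= n] keeps the
    subtraction [q ^ n - q ^ 3] exact. *)
Lemma natr_card_neighbours (N : 'M[F]_n) : (3 <= n)%N ->
  alternating N -> \rank N = 2%N ->
  #|alt2 (fun M => \rank (N - M)%R == 2%N)|%:R =
    Q ^+ n + Q ^+ (n - 1) - Q ^+ 2 - 2 :> R.
Proof.
move=> n3 aN rN; have q1 := card_finRing_gt1 F; have Q1 := natr_field_gt1.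
have /(congr1 (fun k => k%:R : R)) := card_alt2_neighbours aN rN.
rewrite natrD !natrM -natr1 !natrB ?natrX; first last.
- by rewrite expn_gt0 ltnW.
- by rewrite leq_exp2l // ltnW.
- by rewrite leq_exp2l.
- by rewrite expn_gt0 ltnW.
- by rewrite -{1}[q]expn1 leq_exp2l // (leq_trans _ n3).
have -> : Q ^+ n = Q * Q ^+ (n - 1) by rewrite -exprS subn1 prednK // (leq_trans _ n3).
move=> e; apply: (mulIf (mulf_neq0 natr_field_neq0 natr_field_sqrB1_neq0)).
move: e; move: (#|_|%:R) => c e; lra.
Qed.

Lemma natr_card_alt2_eigenvalue : (0 < n)%N ->
  #|@alt2 F n predT|%:R = alt_eigenvalue 0 :> R.
Proof.
move=> n0; rewrite natr_card_alt2 // /alt_eigenvalue muln0 subn0; congr (_ / _).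
have -> : (2 * n - 1 = n + (n - 1))%N by lia.
by rewrite exprD; ring.
Qed.

(** A closed 3-walk is a neighbour of [u] followed by a common neighbour of the two, hence the
    product of the degree and the preceding count. *)
Lemma adjmx3_alt_graph u : (3 <= n)%N ->
  (A ^+ 3) u u = alt_eigenvalue 0 * (Q ^+ n + Q ^+ (n - 1) - Q ^+ 2 - 2).
Proof.
move=> n3; rewrite -[A ^+ 3]/(A *m (A *m A)) mxE.
under eq_bigr => i _.
  rewrite !mxE; under eq_bigr => j _ do rewrite !mxE /alt_graph.
  over.
pose U := enum_val u.
pose f (N : 'M[F]_n) : R := (\rank N == 2%N)%:R.
pose h (B : Alt n F) : R := f (val U - val B) *
  \sum_(C : Alt n F) f (val B - val C) * f (val C - val U).
rewrite (eq_bigr (fun i => h (enum_val i))); last first.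
  move=> i _; rewrite /h -sum_enum; congr (_ * _).
rewrite sum_enum.
pose g N := f N * (Q ^+ n + Q ^+ (n - 1) - Q ^+ 2 - 2).
rewrite (eq_bigr (fun B => g (val B - val U))); last first.
  move=> B _; rewrite /h /g /f -opprB mxrank_opp.
  have [rB | _] := eqVneq (\rank _) 2%N; last by rewrite !mul0r.
  have aB : alternating (val B - val U).
    by rewrite alternatingB ?(valP B) ?(valP U).
  rewrite !mul1r -(natr_card_neighbours n3 aB rB) -sum_alt2 -(sum_Alt U).
  apply: eq_bigr => C _; rewrite -natrM mulnb andbC.
  by rewrite opprB addrA subrK.
rewrite sum_Alt -mulr_suml -natr_card_alt2_eigenvalue ?(leq_trans _ n3) //.
by rewrite -sum_alt2; congr (_ * _); apply: eq_bigr => N _; rewrite andbT.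
Qed.

(** The diagonal is constant and nonnegative, so the starting value 0 of the maximum does not alter
    it. *)
Lemma max_diag_alt_graph : (3 <= n)%N ->
  max_diag (A ^+ 3) = alt_eigenvalue 0 * (Q ^+ n + Q ^+ (n - 1) - Q ^+ 2 - 2).
Proof.
move=> n3; rewrite /max_diag.
pose u0 := enum_rank (Sub 0 (alternating0 F n) : Alt n F).
rewrite (eq_bigr (fun=> (A ^+ 3) u0 u0)) => [|u _]; last first.
  by rewrite !adjmx3_alt_graph.
rewrite -(adjmx3_alt_graph u0 n3).
have ge0 : 0 <= (A ^+ 3) u0 u0.
  rewrite -[A ^+ 3]/(A *m (A *m A)) mxE sumr_ge0 // => i _.
  rewrite mxE mulr_ge0 ?mxE ?sumr_ge0 // => j _.
  by rewrite !mxE mulr_ge0.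
apply/le_anti/andP; split; first exact: bigmax_le.
exact: (le_bigmax _ (fun=> (A ^+ 3) u0 u0) u0).
Qed.

Lemma alt_eigenvalue_decr x y : (x < y)%N -> (2 * y <= n)%N ->
  alt_eigenvalue y < alt_eigenvalue x.
Proof.
move=> xy yn; have Q1 := natr_field_gt1.
rewrite /alt_eigenvalue ltr_pM2r ?invr_gt0; last first.
  by rewrite subr_gt0 exprn_egt1.
rewrite !ltrD2r ltr_eXn2l //; lia.
Qed.

End Graph.

(** Sending [i] to the index of [s i] among the [t j] is a strictly increasing self-map of
    [0, ..., d], hence the identity: induction from the bottom bounds it below, from the top
    above. *)
Lemma decreasing_unique (R : realFieldType) (d : nat) (s t : nat -> R) :
  (forall i j, (i < j <= d)%N -> s j < s i) ->
  (forall i j, (i < j <= d)%N -> t j < t i) ->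
  (forall i, (i <= d)%N -> exists2 j, (j <= d)%N & s i = t j) ->
  forall i, (i <= d)%N -> t i = s i.
Proof.
move=> ds dt st.
have lt_index i j k l : (i < j <= d)%N -> (k <= d)%N -> (l <= d)%N ->
    s i = t k -> s j = t l -> (k < l)%N.
  move=> ij kd ld ei ej; have := ds _ _ ij; rewrite ei ej => tlk.
  rewrite ltnNge leq_eqVlt; apply/negP => /orP[/eqP e | lk].
    by rewrite e ltxx in tlk.
  by have := lt_trans tlk (dt _ _ (introT andP (conj lk kd))); rewrite ltxx.
have lower i : (i <= d)%N -> forall k, (k <= d)%N -> s i = t k -> (i <= k)%N.
  elim: i => // i IH id k kd e.
  have [j jd ej] := st i (ltnW id).
  apply: leq_ltn_trans (IH (ltnW id) j jd ej) _.
  by apply: (lt_index i i.+1) => //; rewrite ltnSn.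
have upper e : forall i, (i + e = d)%N -> forall k, (k <= d)%N -> s i = t k ->
    (k <= i)%N.
  elim: e => [|e IH] i ie k kd ek; first by rewrite -[i]addn0 ie.
  have id : (i.+1 <= d)%N by lia.
  have [j jd ej] := st i.+1 id.
  have := IH i.+1 ltac:(lia) j jd ej.
  have : (k < j)%N by apply: (lt_index i i.+1) => //; rewrite ltnSn.
  lia.
move=> i id; have [k kd e] := st i id.
have ik := lower i id k kd e; have ki := upper (d - i)%N i (subnKC id) k kd e.
by rewrite e (_ : k = i) //; lia.
Qed.

(** * The ratio bound *)

Section RatioAlgebra.
Variable R : realFieldType.
Implicit Types (Q a t : R).

(* Stands for an eigenvalue when [a = Q ^+ (n - 1)] and
   [t = Q ^+ (2 * n - 2 * x - 1)]. *)
Definition eig_form Q a t : R := (t - Q * a - a + 1) / (Q ^+ 2 - 1).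

Lemma eig_formB Q a t t' :
  eig_form Q a t - eig_form Q a t' = (t - t') / (Q ^+ 2 - 1).
Proof. by rewrite -mulrBl; congr (_ / _); ring. Qed.

(** For [n = 2m], the indices [m - 2], [m - 1], [m] give the powers [Q ^+ 4 * a], [Q ^+ 2 * a], [a].
    The bound on [a] keeps the denominators nonzero. *)
Lemma ratio_even Q a : 1 < Q -> Q ^+ 3 < a ->
  let th := eig_form Q a in
  let D := th (Q * a ^+ 2) * (Q * a + a - Q ^+ 2 - 2) in
  (D - th (Q * a ^+ 2) * (th (Q ^+ 4 * a) + th (Q ^+ 2 * a) + th a)
     - th (Q ^+ 4 * a) * th (Q ^+ 2 * a) * th a) /
  ((th (Q * a ^+ 2) - th (Q ^+ 4 * a)) * (th (Q * a ^+ 2) - th (Q ^+ 2 * a)) *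
     (th (Q * a ^+ 2) - th a)) = (a ^+ 3)^-1.
Proof.
move=> Q1 Qa th D.
have Q0 : Q != 0 by lra.
have Q2 : Q ^+ 2 - 1 != 0 by nra.
have Qlt : Q < Q ^+ 3 by rewrite -{1}[Q]expr1 ltr_eXn2l.
have a0 : a != 0 by lra.
have d3 : a - Q ^+ 3 != 0 by lra.
have d1 : a - Q != 0 by lra.
have d0 : Q * a - 1 != 0 by nra.
have e3 : Q * a ^+ 2 - Q ^+ 4 * a = Q * a * (a - Q ^+ 3) by ring.
have e1 : Q * a ^+ 2 - Q ^+ 2 * a = Q * a * (a - Q) by ring.
have e0 : Q * a ^+ 2 - a = a * (Q * a - 1) by ring.
rewrite /D !eig_formB /th /eig_form; field.
by rewrite e3 e1 e0 !mulf_neq0 // a0 Q2.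
Qed.

(** For [n = 2m + 1] the same three powers gain a factor [Q], so [c], which stands for [Q ^+ n],
    replaces [a] there. *)
Lemma ratio_odd Q a : 1 < Q -> Q ^+ 4 < a ->
  let th := eig_form Q a in
  let D := th (Q * a ^+ 2) * (Q * a + a - Q ^+ 2 - 2) in
  let c := Q * a in
  (D - th (Q * a ^+ 2) * (th (Q ^+ 4 * c) + th (Q ^+ 2 * c) + th c)
     - th (Q ^+ 4 * c) * th (Q ^+ 2 * c) * th c) /
  ((th (Q * a ^+ 2) - th (Q ^+ 4 * c)) * (th (Q * a ^+ 2) - th (Q ^+ 2 * c)) *
     (th (Q * a ^+ 2) - th c)) = (c ^+ 3)^-1.
Proof.
move=> Q1 Qa th D c.
have Q0 : Q != 0 by lra.
have Q2 : Q ^+ 2 - 1 != 0 by nra.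
have Qlt : Q ^+ 2 < Q ^+ 4 by rewrite ltr_eXn2l.
have Q1lt : 1 < Q ^+ 2 by rewrite exprn_egt1.
have a0 : a != 0 by lra.
have d4 : a - Q ^+ 4 != 0 by lra.
have d2 : a - Q ^+ 2 != 0 by lra.
have d0 : a - 1 != 0 by lra.
have e4 : Q * a ^+ 2 - Q ^+ 4 * (Q * a) = Q * a * (a - Q ^+ 4) by ring.
have e2 : Q * a ^+ 2 - Q ^+ 2 * (Q * a) = Q * a * (a - Q ^+ 2) by ring.
have e0 : Q * a ^+ 2 - Q * a = Q * a * (a - 1) by ring.
rewrite /D !eig_formB /th /eig_form /c; field.
by rewrite e4 e2 e0 !mulf_neq0 // a0 Q0 Q2.
Qed.

End RatioAlgebra.

Theorem theorem3p20 (R : realType) (q n : nat) (F : finFieldType)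
    (hq : #|F| = q) (hn : (8 <= n)%N) (theta : nat -> R) :
  let m := (n %/ 2)%N in
  let s := (m - 2)%N in
  let A : 'M[R]_#|Alt n F| := adjmx R (@alt_graph n F) in
  let Delta : R := max_diag (A ^+ 3) in
  distinct_eigenvalues A m theta ->
  q%:R `^ (n%:R * (n%:R - 1) / 2) *
    ((Delta - theta 0%N * (theta s + theta s.+1 + theta m)
        - theta s * theta s.+1 * theta m) /
     ((theta 0%N - theta s) * (theta 0%N - theta s.+1) *
        (theta 0%N - theta m)))
  = q%:R `^ (n%:R * (n%:R - 1) / (2 * m%:R) * (m%:R - 3)) :> R.
Proof.
move=> m s A Delta [theta_decr theta_eig].
have m4 : (4 <= m)%N by rewrite /m; lia.
have mn : (2 * m <= n)%N by rewrite /m; lia.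
(* The [m + 1] known eigenvalues are decreasing and occur among the [m + 1] values of [theta], so
   the two lists agree. *)
have thetaE i : (i <= m)%N -> theta i = alt_eigenvalue R F n i.
  move: i; apply: decreasing_unique => // [i j /andP[ij jm] | i im].
    by apply: alt_eigenvalue_decr => //; lia.
  by apply/theta_eig/alt_graph_eigenvalue; lia.
rewrite /Delta max_diag_alt_graph ?(leq_trans _ hn) //.
have sm : (s < m)%N by rewrite /s; lia.
rewrite (thetaE 0%N) // (thetaE s (ltnW sm)) (thetaE s.+1 sm) (thetaE m) //.
set Q : R := q%:R; set a := Q ^+ (n - 1).
have Q1 : 1 < Q by rewrite /Q -hq natr_field_gt1.
have Q0 : Q != 0 by rewrite gt_eqF // (lt_trans ltr01).
have Qpos : 0 <= Q by rewrite ltW // (lt_trans ltr01).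
have Qn : Q ^+ n = Q * a by rewrite /a -exprS; congr (_ ^+ _); lia.
have eigE x k : (2 * n - 2 * x - 1 = k)%N ->
    alt_eigenvalue R F n x = eig_form Q a (Q ^+ k).
  by move=> <-; rewrite /alt_eigenvalue hq -/Q Qn.
have top : Q ^+ (2 * n - 2 * 0 - 1) = Q * a ^+ 2.
  by rewrite /a -exprM -exprS; congr (_ ^+ _); lia.
rewrite hq -/Q Qn -/a (eigE 0%N _ erefl) top.
have [n_odd | n_even] := boolP (odd n).
- have nE : n = (2 * m).+1 by rewrite /m; lia.
  have nR : n%:R = 2 * m%:R + 1 :> R by rewrite nE -natr1 natrM.
  rewrite (eigE s (4 + (1 + (n - 1)))%N); last by rewrite /s; lia.
  rewrite (eigE s.+1 (2 + (1 + (n - 1)))%N); last by rewrite /s; lia.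
  rewrite (eigE m (1 + (n - 1))%N); last by lia.
  rewrite !exprD -/a expr1 ratio_odd //; last by rewrite /a ltr_eXn2l //; lia.
  rewrite -Qn -exprM.
  (* Both real exponents are natural numbers, so [powR] becomes an ordinary power. *)
  have -> : n%:R * (n%:R - 1) / 2 = (m * n)%N%:R :> R.
    by rewrite natrM nR; field.
  have -> : n%:R * (n%:R - 1) / (2 * m%:R) * (m%:R - 3) = (n * (m - 3))%N%:R :> R.
    rewrite natrM natrB ?(leq_trans _ m4) // nR.
    by field; rewrite pnatr_eq0 -lt0n (leq_trans _ m4).
  rewrite !powR_mulrn //.
  (* The ratio equals [Q] to the power [-3n], which removes the last summand. *)
  have -> : (m * n = n * (m - 3) + n * 3)%N by lia.
  by rewrite exprD mulfK // expf_neq0.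
have nE : n = (2 * m)%N by rewrite /m; lia.
have nR : n%:R = 2 * m%:R :> R by rewrite nE natrM.
rewrite (eigE s (4 + (n - 1))%N); last by rewrite /s; lia.
rewrite (eigE s.+1 (2 + (n - 1))%N); last by rewrite /s; lia.
rewrite (eigE m (n - 1)%N); last by lia.
rewrite !exprD -/a ratio_even //; last by rewrite /a ltr_eXn2l //; lia.
rewrite /a -exprM.
have -> : n%:R * (n%:R - 1) / 2 = (m * (n - 1))%N%:R :> R.
  by rewrite natrM natrB ?(leq_trans _ hn) // nR; field.
have -> : n%:R * (n%:R - 1) / (2 * m%:R) * (m%:R - 3) =
    ((n - 1) * (m - 3))%N%:R :> R.
  rewrite natrM !natrB ?(leq_trans _ m4) ?(leq_trans _ hn) // nR.
  by field; rewrite pnatr_eq0 -lt0n (leq_trans _ m4).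
rewrite !powR_mulrn //.
(* Here the ratio contributes the exponent [-3(n - 1)]. *)
have -> : (m * (n - 1) = (n - 1) * (m - 3) + (n - 1) * 3)%N by nia.
by rewrite exprD mulfK // expf_neq0.
Qed.
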